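(* Let $k\ge4$ be even and let $G$ be a simple graph possibly with loops; for each vertex $u$ of $G$ regard $u$ as a designated vertex of its half edge $\mathbf{u}$ in $G^{k,\frac{k}{2}}$. Let $\lambda$ be an eigenvalue of $\mathcal{L}(G^{k,\frac{k}{2}})$ with eigenvector $\mathbf{x}$, and suppose $\lambda\notin\{d_{\mathbf{u}}:u\in V(G)\}$. (Then all entries of $\mathbf{x}$ on a half edge have the same modulus $|\mathbf{x}_{\mathbf{u}}|$.) Let $\mathbf{U}=\bigcup\{\mathbf{u}:|\mathbf{x}_{\mathbf{u}}|>0\}$ and $U=\{u\in V(G):\mathbf{u}\subseteq\mathbf{U}\}$, and for $u\in U$ let $\mathcal{E}_u=\mathbf{x}^{\mathbf{u}}/\mathbf{x}_u^{k/2}$ where $\mathbf{x}^S=\prod_{v\in S}\mathbf{x}_v$, and $\mathcal{E}=\mathrm{diag}\{\mathcal{E}_u:u\in U\}$. Then: (1) the sub-hypergraph $G^{k,\frac{k}{2}}[\mathbf{U}]$ (vertex set $\mathbf{U}$, edges of $G^{k,\frac{k}{2}}$ contained in $\mathbf{U}$) contains no isolated half edges, and hence the induced subgraph $G[U]$ contains no isolated vertices; (2) $\lambda$ is an eigenvalue of the principal subtensor $\mathcal{L}(G^{k,\frac{k}{2}})[\mathbf{U}]$ with $\mathbf{x}[\mathbf{U}]$ (the restriction of $\mathbf{x}$ to $\mathbf{U}$) as an eigenvector; (3) $\lambda$ is an eigenvalue of the matrix $\mathcal{L}^{\mathcal{E}}(G^{o}[U])=D(G^o[U])-\mathcal{E}A(G[U])\mathcal{E}$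 with an eigenvector $x$ given by $x_u=\mathbf{x}_u^{k/2}$ for $u\in U$.
   Context: Tensors: for a real order-$k$, dimension-$n$ tensor $\mathcal{T}$ and $x\in\mathbb{C}^n$, $(\mathcal{T}x^{k-1})_i=\sum_{i_2,\dots,i_k}t_{ii_2\dots i_k}x_{i_2}\cdots x_{i_k}$; $\lambda\in\mathbb{C}$ is an eigenvalue with eigenvector $x\ne0$ if $\mathcal{T}x^{k-1}=\lambda x^{[k-1]}$, $x^{[k-1]}=(x_i^{k-1})_i$. For $S\subseteq[n]$, the principal subtensor $\mathcal{T}[S]$ is the array $(t_{i_1\dots i_k})_{i_1,\dots,i_k\in S}$. Hypergraphs: a hypergraph with loops is a $k$-uniform hypergraph with some added edges (loops) of size $<k$; degree $d_v$ = number of edges (loops included) containing $v$. Adjacency tensor $\mathcal{A}$: $a_{i_1\dots i_k}=\frac{1}{(k-1)!}$ if $\{v_{i_1},\dots,v_{i_k}\}$ is an edge of size $k$, else $0$; $\mathcal{D}$ diagonal with $d_{i\dots i}=d_{v_i}$; Laplacian tensor $\mathcal{L}=\mathcal{D}-\mathcal{A}$. Graphs with loops: a loop is a one-vertex edge; $A(\cdot)$ is the adjacency matrix ignoring loops and $D(\cdot)$ the diagonal degree matrix, each loop contributing $1$. For $U\subseteq V(G)$, $G[U]$ is the induced subgraph and the modified induced subgraph $G^o[U]$ is $G[U]$ together with $d_v(G)-d_v(G[U])$ additional loops at each $v\in U$ (so its degrees equal those in $G$). Generalized power $G^{k,\frac{k}{2}}$ ($k\ge4$ even): replace each vertex $v$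 of $G$ by a set $\mathbf{v}$ of $\frac{k}{2}$ vertices containing $v$ (pairwise disjoint), called a half edge; each edge $\{u,v\}$ of $G$ gives the edge $\mathbf{u}\cup\mathbf{v}$, each loop $\{u\}$ gives the loop $\mathbf{u}$. $d_{\mathbf{u}}$ is the common degree of the vertices of $\mathbf{u}$. *)

(* Defs.v *)
From HB Require Import structures.
From mathcomp Require Import all_boot all_order all_algebra.
From mathcomp Require Import reals complex.

Set Implicit Arguments.
Unset Strict Implicit.
Unset Printing Implicit Defensive.

Import Order.TTheory GRing.Theory Num.Theory.

Local Open Scope ring_scope.
Local Open Scope complex_scope.

(* A real tensor of order k on the index set I; the entry t_{i_1 ... i_k} is
   the value at the tuple (i_1, ..., i_k). *)
Definition tensor (R : Type) (k : nat) (I : finType) := k.-tuple I -> R.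

(* (T x^{k-1})_i : the index tuples (i, i_2, ..., i_k) are the k-tuples t with
   head i, and (i_2, ..., i_k) is then behead t (for k > 0). *)
Definition tensor_apply (R : realType) (k : nat) (I : finType)
    (T : tensor R k I) (x : {ffun I -> R[i]}) (i : I) : R[i] :=
  \sum_(t : k.-tuple I | ohead t == Some i)
     (T t)%:C * \prod_(j <- behead t) x j.

Definition tensor_eigenpair (R : realType) (k : nat) (I : finType)
    (T : tensor R k I) (lambda : R[i]) (x : {ffun I -> R[i]}) : Prop :=
  x != 0 /\ forall i, tensor_apply T x i = lambda * x i ^+ k.-1.

Definition principal_subtensor (R : Type) (k : nat) (I : finType)
    (T : tensor R k I) (S : {set I}) : tensor R k {i : I | i \in S} :=
  fun t => T (map_tuple val t).
Arguments principal_subtensor {R k I} T S t.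

Definition diag_tensor (R : zmodType) (k : nat) (I : finType) (d : I -> R) :
    tensor R k I :=
  fun t => if tval t is i :: s then (if all (pred1 i) s then d i else 0) else 0.

Definition mx_eigenpair (F : fieldType) (n : nat) (M : 'M[F]_n) (lambda : F)
    (y : 'cV[F]_n) : Prop :=
  y != 0 /\ M *m y = lambda *: y.

(* Hypergraphs with loops.  Loops carry a multiplicity, as the modified induced
   subgraphs below may have several loops at the same vertex. *)
Record lhypergraph (k : nat) (V : finType) := LHypergraph {
  hedges : {set {set V}};
  hloops : {set V} -> nat;
  card_hedge : forall e, e \in hedges -> #|e| = k;
  card_hloop : forall l, (0 < hloops l)%N -> (0 < #|l| < k)%N
}.

Section Hypergraph.
Variables (k : nat) (V : finType) (H : lhypergraph k V).

Definition hdegree (v : V) : nat :=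
  (#|[set e in hedges H | v \in e]| + \sum_(l : {set V} | v \in l) hloops H l)%N.

(* Only edges of size k count, not loops; so a set that is not isolated is met
   by a genuine edge, which is more than having a vertex of positive degree. *)
Definition isolated_set (S : {set V}) : bool :=
  [forall e in hedges H, [disjoint S & e]].

Definition adjacency_tensor (R : realType) : tensor R k V :=
  fun t => if [set v in t] \in hedges H then ((k.-1)`!%:R)^-1 else 0.

Definition laplacian_tensor (R : realType) : tensor R k V :=
  fun t => diag_tensor (fun v => (hdegree v)%:R) t - adjacency_tensor R t.

Section Induced.
Variable W : {set V}.

Let T := {v : V | v \in W}.

Definition hinduced_edges : {set {set T}} :=
  [set e : {set T} | val @: e \in hedges H].

Definition hinduced_loops (l : {set T}) : nat := hloops H (val @: l).

Lemma hinduced_card_edge e : e \in hinduced_edges -> #|e| = k.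
Proof. by rewrite inE => /card_hedge <-; rewrite (card_imset _ val_inj). Qed.

Lemma hinduced_card_loop l :
  (0 < hinduced_loops l)%N -> (0 < #|l| < k)%N.
Proof. by move=> /card_hloop; rewrite (card_imset _ val_inj). Qed.

Definition hinduced : lhypergraph k T :=
  LHypergraph hinduced_card_edge hinduced_card_loop.

End Induced.
End Hypergraph.

(* Simple graphs possibly with loops, the loops at a vertex being counted with
   multiplicity. *)
Record lgraph (V : finType) := LGraph {
  gadj : rel V;
  gloops : V -> nat;
  gadj_sym : symmetric gadj;
  gadj_irr : irreflexive gadj
}.

Section Graph.
Variables (V : finType) (G : lgraph V).

Definition gdegree (v : V) : nat := (#|[set w | gadj G v w]| + gloops G v)%N.

(* As for [isolated_set], loops do not count. *)
Definition isolated_vertex (v : V) : bool := [forall w, ~~ gadj G v w].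

Definition adjacency_mx (F : nzRingType) : 'M[F]_#|V| :=
  \matrix_(i, j) (gadj G (enum_val i) (enum_val j))%:R.

Definition degree_mx (F : nzRingType) : 'M[F]_#|V| :=
  diag_mx (\row_i (gdegree (enum_val i))%:R).

Section Induced.
Variable U : {set V}.

Let T := {v : V | v \in U}.

Definition ginduced_adj : rel T := fun v w => gadj G (val v) (val w).

Lemma ginduced_sym : symmetric ginduced_adj.
Proof. by move=> v w; rewrite /ginduced_adj gadj_sym. Qed.

Lemma ginduced_irr : irreflexive ginduced_adj.
Proof. by move=> v; rewrite /ginduced_adj gadj_irr. Qed.

Definition ginduced : lgraph T :=
  LGraph (fun v => gloops G (val v)) ginduced_sym ginduced_irr.

End Induced.
End Graph.

(* The truncated subtraction is harmless: degrees in G[U] are at most those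
   in G. *)
Definition gmod_induced (V : finType) (G : lgraph V) (U : {set V}) :
    lgraph {v : V | v \in U} :=
  LGraph
    (fun v => gloops (ginduced G U) v
              + (gdegree G (val v) - gdegree (ginduced G U) v))%N
    (@ginduced_sym V G U) (@ginduced_irr V G U).

Lemma gmod_induced_degree (V : finType) (G : lgraph V) (U : {set V}) v :
  gdegree (gmod_induced G U) v = gdegree G (val v).
Proof.
have le_deg : (gdegree (ginduced G U) v <= gdegree G (val v))%N.
  rewrite leq_add2r -(card_imset _ val_inj).
  by apply/subset_leq_card/subsetP => w /imsetP[u]; rewrite inE => + ->; rewrite inE.
by rewrite -[RHS](subnKC le_deg) /gdegree addnA.
Qed.

(* Generalized powers: the vertex v of G is replaced by the half edge
   {v} * {0, ..., k/2 - 1}. *)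
Section GeneralizedPower.
Variables (k : nat) (V : finType).

Definition half_edge (v : V) : {set V * 'I_(k./2)} := [set w | w.1 == v].

Lemma card_half_edge v : #|half_edge v| = k./2.
Proof.
have -> : half_edge v = [set (v, i) | i : 'I_(k./2)].
  apply/setP => -[w i]; rewrite inE /=; apply/eqP/imsetP => [-> | [j _ [-> _]]//].
  by exists i.
by rewrite card_imset ?card_ord // => i j [].
Qed.

Variable G : lgraph V.

Definition gpower_edges : {set {set V * 'I_(k./2)}} :=
  [set half_edge e.1 :|: half_edge e.2 | e : V * V & gadj G e.1 e.2].

Definition gpower_loops (l : {set V * 'I_(k./2)}) : nat :=
  (\sum_(u | half_edge u == l) gloops G u)%N.

Hypotheses (k_ge4 : (4 <= k)%N) (k_even : ~~ odd k).

Lemma gpower_card_edge e : e \in gpower_edges -> #|e| = k.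
Proof.
case/imsetP => -[u v]; rewrite inE /= => uv ->.
rewrite cardsU !card_half_edge.
have -> : half_edge u :&: half_edge v = set0.
  apply/setP => w; rewrite !inE; apply/negP => /andP[/eqP-> /eqP E].
  by rewrite E gadj_irr in uv.
by rewrite cards0 subn0 addnn even_halfK.
Qed.

Lemma gpower_card_loop l : (0 < gpower_loops l)%N -> (0 < #|l| < k)%N.
Proof.
rewrite lt0n sum_nat_eq0 => /forallPn[u].
rewrite negb_imply => /andP[/eqP <- _].
rewrite card_half_edge half_gt0 (leq_trans _ k_ge4) //=.
by rewrite -[X in (_ < X)%N](even_halfK k_even) -addnn -[X in (X < _)%N]addn0
  ltn_add2l half_gt0 (leq_trans _ k_ge4).
Qed.

Definition gpower : lhypergraph k (V * 'I_(k./2))%type :=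
  LHypergraph gpower_card_edge gpower_card_loop.

Lemma gpower_degree u i : hdegree gpower (u, i) = gdegree G u.
Proof.
have half_inj : injective half_edge.
  move=> v w /setP/(_ (v, i)); rewrite !inE /= eqxx => /esym/eqP //.
congr addn.
  pose f v := half_edge u :|: half_edge v.
  have f_inj : {in [set w | gadj G u w] &, injective f}.
    move=> v w; rewrite !inE => uv uw /setP/(_ (v, i)); rewrite !inE /= eqxx orbT.
    move/esym/orP => [/eqP E|/eqP //].
    by rewrite E gadj_irr in uv.
  rewrite -(card_in_imset f_inj); congr #|pred_of_set _|.
  apply/setP => e; rewrite !inE; apply/andP/imsetP => [[/imsetP[[v w]]]|[w]].
    rewrite inE /= => vw -> /setUP[]; rewrite inE /= => /eqP E; subst u.
      by exists w; rewrite ?inE.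
    by exists v; rewrite ?inE 1?gadj_sym // /f setUC.
  rewrite inE => uw ->; split; last by rewrite !inE /= eqxx.
  by apply/imsetP; exists (u, w); rewrite ?inE.
rewrite /= /gpower_loops (exchange_big_dep predT) //=.
rewrite (bigD1 u) //= [X in (_ + X)%N]big1 ?addn0 => [|v /negbTE vu].
  rewrite (big_pred1 (half_edge u)) // => l.
  rewrite andbC /= eq_sym; case: eqP => //= ->; by rewrite inE eqxx.
apply: big1 => l /andP[ul /eqP E]; move: ul; rewrite -E inE /= eq_sym vu //.
Qed.

End GeneralizedPower.

(* Main.v *)
(* Multiply the eigenvalue equation at the vertex (u, i) by x_(u, i): each edge
   monomial becomes the product X_u X_v of the entries on two half edges, so
   (d_u - lambda) x_(u, i)^k = X_u * sum_(v ~ u) X_v, whose right-hand side does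
   not depend on i.  As lambda != d_u, the powers x_(u, i)^k agree on the half
   edge of u; and where x does not vanish the sum has a nonzero term, which gives
   a neighbour of u in the support.  Dividing by x_u^(k/2) gives the matrix
   eigenvalue equation. *)
Require Import Defs.
From HB Require Import structures.
From mathcomp Require Import all_boot all_order all_algebra.
From mathcomp Require Import reals complex.

Set Implicit Arguments.
Unset Strict Implicit.
Unset Printing Implicit Defensive.

Import Order.TTheory GRing.Theory Num.Theory.

Local Open Scope ring_scope.
Local Open Scope complex_scope.

(** Summing over the free indices (i_2, ..., i_k) alone removes the side condition on the head, so
    the sum can be reindexed and partitioned directly. *)
Lemma tensor_apply_cons (R : realType) n (I : finType) (T : tensor R n.+1 I)
    (x : {ffun I -> R[i]}) i :
  tensor_apply T x i =
  \sum_(s : n.-tuple I) (T [tuple of i :: s])%:C * \prod_(j <- s) x j.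
Proof.
rewrite /tensor_apply (reindex_onto (fun s : n.-tuple I => [tuple of i :: s])
  (fun t : n.+1.-tuple I => [tuple of behead t])) /=.
  apply: eq_bigl => s; rewrite eqxx /=.
  by apply/eqP/val_inj.
move=> t; rewrite {1}(tuple_eta t) /= => /eqP[<-].
by rewrite [RHS]tuple_eta; apply: val_inj.
Qed.

(** * Contraction of differences, diagonal tensors and principal subtensors *)

Section Tensors.
Variables (R : realType) (I : finType).
Implicit Types (x : {ffun I -> R[i]}) (i : I).

Lemma tensor_applyB k (T1 T2 : tensor R k I) x i :
  tensor_apply (fun t => T1 t - T2 t) x i =
  tensor_apply T1 x i - tensor_apply T2 x i.
Proof. by rewrite -sumrB; apply: eq_bigr => t _; rewrite rmorphB mulrBl. Qed.

Lemma diag_tensor_apply k (d : I -> R) x i : (0 < k)%N ->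
  tensor_apply (diag_tensor (k := k) d) x i = (d i)%:C * x i ^+ k.-1.
Proof.
case: k => // n _; rewrite tensor_apply_cons (bigD1 (nseq_tuple n i)) //=.
rewrite /diag_tensor /= all_nseq /= eqxx orbT big_nseq -Monoid.iteropE /=.
rewrite [X in _ + X]big1 ?addr0 // => s; case: ifP; last by rewrite mul0r.
by move/all_pred1P; rewrite size_tuple => si /eqP[]; apply: val_inj.
Qed.

(** A monomial with an index outside [S] vanishes because [x] does there; the remaining index tuples
    are exactly the tuples over the subtype. *)
Lemma principal_subtensor_apply k (T : tensor R k I) (S : {set I}) x
    (i : {i | i \in S}) :
  (forall j, j \notin S -> x j = 0) ->
  tensor_apply (principal_subtensor T S) [ffun j => x (val j)] i =
  tensor_apply T x (val i).
Proof.
case: k T => [|n] T x0.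
  (* In order 0 the only tuple has no head, so both sums are empty. *)
  by rewrite /tensor_apply !big1 // => t; rewrite tuple0.
rewrite !tensor_apply_cons [RHS](bigID (fun s : n.-tuple I => all [in S] s)) /=.
rewrite [X in _ + X]big1 ?addr0 => [|s /allPn[j js /x0 xj]]; last first.
  by rewrite (big_rem j) //= xj mul0r mulr0.
pose f (s : n.-tuple {i | i \in S}) := map_tuple val s.
(* The default [i] of [insubd] is never reached, as only tuples with all entries in [S] are left. *)
pose g (t : n.-tuple I) : n.-tuple {i | i \in S} := map_tuple (insubd i) t.
rewrite [RHS](reindex_onto f g) => [|t /allP tS]; last first.
  apply: val_inj; rewrite /= -map_comp map_id_in // => j /tS jS.
  by rewrite /= insubdK.
apply: eq_big => [s|s _].
  apply/esym/andP; split; first by apply/allP => _ /mapP[j _ ->]; apply: valP.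
  by apply/eqP/val_inj; rewrite /= -map_comp map_id_in // => j _ /=; apply: valKd.
rewrite big_map; congr (_%:C * _); first by congr T; apply: val_inj.
by apply: eq_bigr => j _; rewrite ffunE.
Qed.

End Tensors.

(** * The adjacency and Laplacian tensors of a hypergraph *)

Section Hypergraphs.
Variables (R : realType) (k : nat) (V : finType) (H : lhypergraph k V).
Hypothesis k_gt0 : (0 < k)%N.
Implicit Types (x : {ffun V -> R[i]}) (v : V).

(** An edge [e] through [v] is hit by the (k-1)! orderings of [e :\ v], which cancels the weight
    1/(k-1)! of each entry. *)
Lemma adjacency_tensor_apply x v :
  tensor_apply (adjacency_tensor H R) x v =
  \sum_(e in hedges H | v \in e) \prod_(w in e :\ v) x w.
Proof.
case: k k_gt0 H => // n _ H'; rewrite tensor_apply_cons.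
(* By counting: [v :: s] has as many entries as [e] has elements, so it covers [e] exactly when it
   lists [e] without repetition. *)
have setE (e : {set V}) (s : n.-tuple V) : #|e| = n.+1 -> v \in e ->
    ([set w in v :: s] == e) = all [in e :\ v] s && uniq s.
  move=> card_e ve; apply/eqP/andP => [se|[/allP se us]].
    have /= /andP[vs us] : uniq (v :: s).
      apply/card_uniqP; rewrite /= size_tuple -card_e -se.
      by apply: eq_card => w; rewrite !inE.
    split=> //; apply/allP => w ws; rewrite !inE -se !inE ws orbT andbT.
    by apply: contraNneq vs => <-.
  apply/eqP; rewrite eqEcard; apply/andP; split.
    by apply/subsetP => w; rewrite !inE => /predU1P[->//|/se/setD1P[]].
  rewrite card_e [#|_|](_ : _ = #|v :: s|); last first.
    by apply: eq_card => w; rewrite inE.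
  suff /card_uniqP -> : uniq (v :: s) by rewrite /= size_tuple.
  by rewrite /= us andbT; apply/negP => /se; rewrite !inE eqxx.
transitivity (\sum_(s : n.-tuple V | [set w in v :: s] \in hedges H')
    ((n`!%:R)^-1)%:C * \prod_(w <- s) x w).
  rewrite [RHS]big_mkcond; apply: eq_bigr => s _.
  by rewrite /adjacency_tensor; case: ifP; rewrite // mul0r.
(* Group the index tuples by the edge that they span together with [v]. *)
rewrite (partition_big (fun s : n.-tuple V => [set w in v :: s])
  (fun e => (e \in hedges H') && (v \in e))) /=; last first.
  by move=> s ->; rewrite !inE eqxx.
apply: eq_bigr => e /andP[eH ve]; have card_e := card_hedge eH.
have card_ev : #|e :\ v| = n by apply/eqP; rewrite -eqSS -card_e (cardsD1 v e) ve.
transitivity (\sum_(s in [set s : n.-tuple V | all [in e :\ v] s & uniq s])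
    ((n`!%:R)^-1)%:C * \prod_(w in e :\ v) x w).
  apply: eq_big => s; first rewrite inE -(setE e s card_e ve) andbC.
    by case: eqP => // ->.
  case/andP=> _; rewrite setE // => /andP[/allP se us]; congr (_ * _).
  have card_s : #|s| = #|e :\ v| by rewrite card_ev (card_uniqP us) size_tuple.
  by rewrite big_uniq //=; apply/eq_bigl/(subset_cardP card_s)/subsetP => w /se.
rewrite sumr_const card_uniq_tuples card_ev ffactnn -mulrnAl -raddfMn /=.
by rewrite -[X in X%:C]mulr_natr mulVf ?mul1r // pnatr_eq0 -lt0n fact_gt0.
Qed.

Lemma laplacian_tensor_apply x v :
  tensor_apply (laplacian_tensor H R) x v =
  (hdegree H v)%:R * x v ^+ k.-1
  - \sum_(e in hedges H | v \in e) \prod_(w in e :\ v) x w.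
Proof.
by rewrite tensor_applyB diag_tensor_apply // adjacency_tensor_apply rmorph_nat.
Qed.

End Hypergraphs.

(** * Edges of a generalized power through a given vertex *)

Section GeneralizedPower.
Variables (k : nat) (V : finType) (G : lgraph V).
Implicit Types u v : V.

Lemma disjoint_half_edge u v : u != v -> [disjoint half_edge k u & half_edge k v].
Proof.
move=> uv; rewrite -setI_eq0; apply/eqP/setP => w; rewrite !inE.
by case: eqP => //= ->; rewrite (negbTE uv).
Qed.

(** The index [i] supplies a point [(v, i)] of the half edge of [v]: it lies in the union formed
    with [w], and [v = u] is excluded by irreflexivity. *)
Lemma half_edgeU_inj u (i : 'I_(k./2)) :
  {in [set v | gadj G u v] &,
    injective (fun v => half_edge k u :|: half_edge k v)}.
Proof.
move=> v w; rewrite !inE => uv _ /setP/(_ (v, i)); rewrite !inE /= eqxx orbT.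
by case/esym/orP=> /eqP // vu; rewrite vu gadj_irr in uv.
Qed.

Lemma gpower_edges_sum (M : nmodType) (F : {set V * 'I_(k./2)} -> M) u i :
  \sum_(e in gpower_edges k G | (u, i) \in e) F e =
  \sum_(v | gadj G u v) F (half_edge k u :|: half_edge k v).
Proof.
transitivity (\sum_(v in [set v | gadj G u v])
    F (half_edge k u :|: half_edge k v)); last first.
  by apply: eq_bigl => v; rewrite inE.
rewrite -(big_imset _ (half_edgeU_inj i)); apply: eq_bigl => e.
apply/andP/imsetP => [[/imsetP[[v w] /= + ->]]|[v]].
  rewrite inE /= => vw; rewrite !inE /= => /orP[] /eqP->.
    by exists w; rewrite ?inE.
  by exists v; rewrite ?inE 1?gadj_sym // setUC.
rewrite inE => uv ->; rewrite !inE eqxx; split=> //.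
by apply/imsetP; exists (u, v); rewrite ?inE.
Qed.

End GeneralizedPower.

(** * Laplacian eigenpairs of a generalized power *)

Section Eigenpairs.
Variables (R : realType) (k : nat) (V : finType) (G : lgraph V).
Implicit Types u v : V.
Hypotheses (k_ge4 : (4 <= k)%N) (k_even : ~~ odd k).
Variables (lambda : R[i]) (x : {ffun V * 'I_(k./2) -> R[i]}).
Let H := gpower G k_ge4 k_even.
Let X u := \prod_(w in half_edge k u) x w.

Lemma gpower_eigen_eq u i :
  tensor_eigenpair (laplacian_tensor H R) lambda x ->
  ((gdegree G u)%:R - lambda) * x (u, i) ^+ k =
  X u * \sum_(v | gadj G u v) X v.
Proof.
have k_gt0 : (0 < k)%N by apply: leq_trans k_ge4.
case=> _ /(_ (u, i)); rewrite laplacian_tensor_apply // gpower_degree.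
have -> : x (u, i) ^+ k = x (u, i) ^+ k.-1 * x (u, i).
  by rewrite -exprSr prednK.
rewrite mulrA mulrBl => <-.
rewrite opprB addrCA subrr addr0 gpower_edges_sum mulr_suml mulr_sumr.
(* The factor [x (u, i)] restores the point missing from the edge, whose product then splits over
   two disjoint half edges. *)
apply: eq_bigr => v uv; rewrite mulrC -big_setD1 ?inE ?eqxx //=.
rewrite -bigU; first by apply: eq_bigl => w; rewrite !inE.
by apply: disjoint_half_edge; apply: contraTneq uv => ->; rewrite gadj_irr.
Qed.

Hypothesis eig : tensor_eigenpair (laplacian_tensor H R) lambda x.
Hypothesis lambda_deg : forall u, lambda != (gdegree G u)%:R.

(** Equal [k]-th powers of complex numbers force only equal moduli, by injectivity of the power on
    nonnegative numbers. *)
Lemma half_edge_eigen_norm u i j : `|x (u, i)| = `|x (u, j)|.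
Proof.
have k_gt0 : (0 < k)%N by apply: leq_trans k_ge4.
apply: (@pexpIrn _ k); rewrite ?nnegrE //= -!normrX; congr `|_|.
have/mulfI : (gdegree G u)%:R - lambda != 0 by rewrite subr_eq0 eq_sym.
by apply; rewrite !gpower_eigen_eq.
Qed.

Lemma half_edge_eigen_neq0 u i j : (x (u, i) != 0) = (x (u, j) != 0).
Proof. by rewrite -!normr_gt0 (half_edge_eigen_norm u i j). Qed.

Lemma half_edge_prod_neq0 u i : (X u != 0) = (x (u, i) != 0).
Proof.
apply/prodf_neq0/idP => [|xu [v j]]; first by apply; rewrite inE.
by rewrite inE => /eqP/= ->; rewrite (half_edge_eigen_neq0 u j i).
Qed.

Lemma half_edge_eigen_neighbor u i : x (u, i) != 0 ->
  exists2 v, gadj G u v & x (v, i) != 0.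
Proof.
move=> xu; have [v /andP[uv]|Xv0] := pickP [pred v | gadj G u v & X v != 0].
  by rewrite (half_edge_prod_neq0 v i); exists v.
have/eqP := gpower_eigen_eq u i eig.
rewrite [\sum_(_ | _) _]big1 => [|v uv]; last first.
  by have/negbT := Xv0 v; rewrite /= uv negbK => /eqP.
by rewrite mulr0 mulf_eq0 expf_eq0 (negbTE xu) andbF orbF subr_eq0 eq_sym
  (negbTE (lambda_deg u)).
Qed.

End Eigenpairs.

Theorem theorem2p3 (R : realType) (k : nat)
    (k_ge4 : (4 <= k)%N) (k_even : ~~ odd k)
    (V : finType) (G : lgraph V) (des : V -> 'I_(k./2))
    (lambda : R[i]) (x : {ffun V * 'I_(k./2) -> R[i]}) :
  let H := gpower G k_ge4 k_even in
  let rep (u : V) := (u, des u) in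
  tensor_eigenpair (laplacian_tensor H R) lambda x ->
  (forall u : V, lambda != (hdegree H (rep u))%:R) ->
  let UU := \bigcup_(u | 0 < `|x (rep u)|) half_edge k u in
  let U := [set u | half_edge k u \subset UU] in
  let E := \row_(i < #|{: {u : V | u \in U}}|)
     ((\prod_(w in half_edge k (val (enum_val i))) x w)
        / x (rep (val (enum_val i))) ^+ k./2) in
  (forall u w, w \in half_edge k u -> `|x w| = `|x (rep u)|) /\
  ((forall u, u \in U ->
      ~~ isolated_set (hinduced H UU) (val @^-1: half_edge k u)) /\
   (forall u : {u : V | u \in U}, ~~ isolated_vertex (ginduced G U) u)) /\
  tensor_eigenpair (principal_subtensor (laplacian_tensor H R) UU) lambda
    [ffun w : {w | w \in UU} => x (val w)] /\
  mx_eigenpair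
    (degree_mx (gmod_induced G U) R[i]
       - diag_mx E *m adjacency_mx (ginduced G U) R[i] *m diag_mx E)
    lambda
    (\col_i x (rep (val (enum_val i))) ^+ k./2).
Proof.
move=> H rep eig lambda_deg UU U E.
have lambda_gdeg u : lambda != (gdegree G u)%:R.
  by have := lambda_deg u; rewrite gpower_degree.
have x_neq0 := half_edge_eigen_neq0 eig lambda_gdeg.
have X_neq0 := half_edge_prod_neq0 eig lambda_gdeg.
(* [UU] is defined through the designated vertices, but it is the whole support of [x], since
   vanishing at one point of a half edge means vanishing on all of it. *)
have memUU w : (w \in UU) = (x w != 0).
  case: w => u i; apply/bigcupP/idP => [[v]|xu].
    by rewrite inE normr_gt0 => + /eqP/= ->; rewrite (x_neq0 v (des v) i).
  by exists u; rewrite ?inE // normr_gt0 (x_neq0 u (des u) i).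
have memU u : (u \in U) = (x (rep u) != 0).
  rewrite inE -memUU; apply/subsetP/idP => [|uUU [v i]].
    by apply; rewrite inE.
  by rewrite inE memUU => /eqP/= ->; rewrite (x_neq0 u i (des u)) -memUU.
split; [|split; [split|split; [split|split]]].
- move=> u [v i]; rewrite inE => /eqP/= ->.
  exact: (half_edge_eigen_norm eig lambda_gdeg).
- move=> u; rewrite memU => xu.
  have [v uv xv] := half_edge_eigen_neighbor eig lambda_gdeg xu.
  have uUU : rep u \in UU by rewrite memUU.
  (* The neighbour [v] in the support yields an edge inside [UU]; its preimage in the subtype is the
     edge that meets the half edge of [u]. *)
  pose e := half_edge k u :|: half_edge k v.
  have eUU : e \subset UU.
    apply/subsetP => -[w i]; rewrite memUU !inE /= => /orP[]/eqP->.
      by rewrite (x_neq0 u i (des u)).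
    by rewrite (x_neq0 v i (des u)).
  apply/forall_inPn; exists (val @^-1: e).
    rewrite inE [val @: _](_ : _ = e).
      by apply/imsetP; exists (u, v); rewrite ?inE.
    apply/setP => w; apply/imsetP/idP => [[w' + ->]|we].
      by rewrite inE.
    have wUU := subsetP eUU w we.
    by exists (Sub w wUU) => //; move: we; rewrite !inE.
  by apply/pred0Pn; exists (Sub (rep u) uUU); rewrite !inE /= eqxx.
- case=> u uU; have := uU; rewrite memU => xu.
  have [v uv xv] := half_edge_eigen_neighbor eig lambda_gdeg xu.
  have vU : v \in U by rewrite memU (x_neq0 v _ (des u)).
  by apply/forallPn; exists (Sub v vU); rewrite negbK.
(* As [x] vanishes outside [UU], a zero restriction would make [x] itself zero. *)
- apply: contraNneq eig.1 => /ffunP x0; apply/eqP/ffunP => w; rewrite ffunE.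
  apply/eqP/negPn/negP; rewrite -memUU => wUU.
  by have := x0 (Sub w wUU); rewrite !ffunE /= => xw; rewrite memUU xw eqxx in wUU.
- move=> w; rewrite principal_subtensor_apply ?ffunE ?eig.2 // => w'.
  by rewrite memUU negbK => /eqP.
- have [u xu] : exists u, x (rep u) != 0.
    apply/existsP; apply: contraR eig.1 => /existsPn x0.
    apply/eqP/ffunP => -[u i]; rewrite ffunE; apply/eqP/negPn; rewrite (x_neq0 u i (des u)); exact: x0.
  have uU : u \in U by rewrite memU.
  apply: contraNneq xu => /matrixP/(_ (enum_rank (Sub u uU : {u | u \in U})) 0).
  by rewrite !mxE enum_rankK /= => /eqP; rewrite expf_eq0 => /andP[].
- apply/colP => i; rewrite mulmxBl -!mulmxA /degree_mx !mul_diag_mx !mxE.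
  rewrite gmod_induced_degree.
  set u := val (enum_val i); set y := x (rep u) ^+ k./2.
  have y_neq0 : y != 0 by rewrite expf_neq0 // -memU (valP (enum_val i)).
  (* Each diagonal entry of [E] times x_v^(k/2) is the product over the half edge of [v]. Neighbours
     outside [U] may be added, as their products vanish. *)
  rewrite (_ : \sum_j _ =
      \sum_(v | gadj G u v) \prod_(w in half_edge k v) x w); last first.
    rewrite (bigID [in U]) /= [X in _ + X]big1 ?addr0; last first.
      by move=> v /andP[_]; rewrite memU -(X_neq0 v (des v)) negbK => /eqP.
    under [RHS]eq_bigl do rewrite andbC.
    rewrite [RHS]big_sub_cond [RHS]big_mkcond [RHS]big_enum_val.
    apply: eq_bigr => j _; rewrite !mxE /= /ginduced_adj.
    case: gadj; rewrite ?mul0r // mul1r divfK // expf_neq0 //.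
    by rewrite -memU (valP (enum_val j)).
  have yy : x (rep u) ^+ k = y * y by rewrite -exprD addnn even_halfK.
  (* The outer diagonal factor divides by [y], and x_u^k is [y * y], so (d_u - lambda) [y]
     remains. *)
  rewrite mulrAC -(gpower_eigen_eq u (des u) eig) yy mulrA mulfK // mulrBl.
  by rewrite opprB addrCA subrr addr0.
Qed.
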